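(* Let $G$ be a (Hausdorff) compact group, and suppose that the set $$\mathcal{N}_2(G)=\{(x_1,x_2,x_3)\in G\times G\times G \;:\; [x_1,x_2,x_3]=1\}$$ has positive Haar measure in $G\times G\times G$. Then $G$ has an open subgroup that is nilpotent of class at most $2$.
   Context: Commutators: $[x,y]=x^{-1}y^{-1}xy$ and $[x,y,z]=[[x,y],z]$. Haar measure on the compact group $G\times G\times G$ means its unique normalized Haar measure. A ''$2$-step nilpotent'' group is a group that is nilpotent of class at most $2$, i.e. $[a,b,c]=1$ for all $a,b,c$ in it. *)

(* Defs.v *)
From HB Require Import structures.
From mathcomp Require Import all_boot all_order all_algebra.
From mathcomp Require Import all_classical all_reals all_analysis.
Set Implicit Arguments. Unset Strict Implicit. Unset Printing Implicit Defensive.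
Import Order.TTheory GRing.Theory Num.Theory.
Local Open Scope classical_set_scope.
Local Open Scope ring_scope.

Definition group_axioms (G : Type) (mul : G -> G -> G) (inv : G -> G) (one : G) :=
  [/\ forall x y z, mul x (mul y z) = mul (mul x y) z,
      forall x, mul one x = x,
      forall x, mul x one = x,
      forall x, mul (inv x) x = one
    & forall x, mul x (inv x) = one].

Definition compact_hausdorff_group (G : ptopologicalType)
  (mul : G -> G -> G) (inv : G -> G) (one : G) :=
  [/\ group_axioms mul inv one,
      continuous (fun p : G * G => mul p.1 p.2),
      continuous inv,
      hausdorff_space G
    & compact [set: G]].

Definition comm (G : Type) (mul : G -> G -> G) (inv : G -> G) (x y : G) : G :=
  mul (mul (mul (inv x) (inv y)) x) y.

Definition comm3 (G : Type) (mul : G -> G -> G) (inv : G -> G) (x y z : G) : G :=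
  comm mul inv (comm mul inv x y) z.

Definition N2 (G : Type) (mul : G -> G -> G) (inv : G -> G) (one : G)
  : set (G * G * G) :=
  [set p | comm3 mul inv p.1.1 p.1.2 p.2 = one].

Definition borel3 (G : ptopologicalType) :=
  g_sigma_algebraType (@open (G * G * G)%type).

Definition mul3 (G : Type) (mul : G -> G -> G) (g p : G * G * G) : G * G * G :=
  (mul g.1.1 p.1.1, mul g.1.2 p.1.2, mul g.2 p.2).

(* mu is the normalized Haar measure of the compact group G x G x G:
   a Borel probability measure, left invariant, and (outer) regular
   (for a finite measure on a compact space outer regularity implies
   inner regularity by compact sets, i.e. mu is Radon). *)
Definition haar_prob (R : realType) (G : ptopologicalType) (mul : G -> G -> G)
  (mu : set (borel3 G) -> \bar R) :=
  [/\ mu setT = 1%E,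
      forall (g : G * G * G) (A : set (borel3 G)), measurable A ->
        mu (mul3 mul g @` A) = mu A
    & forall A : set (borel3 G), measurable A ->
        mu A = ereal_inf [set mu U | U in
                 [set U : set (borel3 G) | @open (G * G * G)%type U /\ A `<=` U]]].

Definition is_subgroup (G : Type) (mul : G -> G -> G) (inv : G -> G) (one : G)
  (H : set G) :=
  [/\ H one, forall x y, H x -> H y -> H (mul x y) & forall x, H x -> H (inv x)].

Definition nilpotent_class_le2 (G : Type) (mul : G -> G -> G) (inv : G -> G)
  (one : G) (H : set G) :=
  forall a b c, H a -> H b -> H c -> comm3 mul inv a b c = one.

(* Main.v *)
Require Import Defs.
From HB Require Import structures.
From mathcomp Require Import all_boot all_order all_algebra.
From mathcomp Require Import all_classical all_reals all_analysis.
From mathcomp Require Import measurable_realfun.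
Import Order.TTheory GRing.Theory Num.Theory.
Local Open Scope classical_set_scope.
Local Open Scope ring_scope.

(** Let N be the set of the triples with [x, y, z] = 1. It is closed and, by
    outer regularity, has an open neighbourhood of only slightly larger measure,
    which contains all the translates of N by elements close to 1; so any
    16 such translates have a common point. Hence, for u, v, w close to 1, there
    are x, y, z with [x u', y v', z w'] = 1 for all u' in {1, u}, v' in {1, v},
    w' in {1, u, v, w}. Varying w' shows that each [x u', y v'] commutes with
    u, v and w; the identity [x u, y] = [x, y]^u [u, y] and its analogue in the
    second variable then show that so does [u, v]. Thus all triple commutators
    vanish on a neighbourhood of 1, and this property passes to the open
    subgroup that it generates.

    The translates used are right ones whereas the measure is left invariant,
    so the argument is run on the set of inverses of N, which has positive
    measure because a left Haar measure of a compact group is invariant under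
    inversion. *)

(* The library declares products of pointed types and of topological types, but
   not their join. *)
HB.instance Definition _ (U V : ptopologicalType) :=
  Topological.on (U * V)%type.

(** * Commutators, centralizers and generated subgroups in an abstract group *)

Section Group.
Context {G : Type} {mul : G -> G -> G} {inv : G -> G} {one : G}.
Hypothesis HG : group_axioms mul inv one.
Local Notation "x ** y" := (mul x y) (at level 40, left associativity).
Local Notation "[ x ~ y ]" := (comm mul inv x y).

Lemma gmulA x y z : x ** (y ** z) = x ** y ** z. Proof. by case: HG. Qed.
Lemma gmul1x x : one ** x = x. Proof. by case: HG. Qed.
Lemma gmulx1 x : x ** one = x. Proof. by case: HG. Qed.
Lemma gmulVx x : inv x ** x = one. Proof. by case: HG. Qed.
Lemma gmulxV x : x ** inv x = one. Proof. by case: HG. Qed.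
Lemma gmulA_rev x y z : x ** y ** z = x ** (y ** z).
Proof. by rewrite gmulA. Qed.
Lemma gmulK x y : inv x ** (x ** y) = y.
Proof. by rewrite gmulA gmulVx gmul1x. Qed.
Lemma gmulVK x y : x ** (inv x ** y) = y.
Proof. by rewrite gmulA gmulxV gmul1x. Qed.
Lemma gmulI x y z : x ** y = x ** z -> y = z.
Proof. by move=> /(congr1 (mul (inv x))); rewrite !gmulK. Qed.
Lemma ginvK x : inv (inv x) = x.
Proof. by apply: (gmulI (inv x)); rewrite gmulxV gmulVx. Qed.
Lemma ginvM x y : inv (x ** y) = inv y ** inv x.
Proof.
by apply: (gmulI (x ** y)); rewrite gmulxV !gmulA_rev gmulVK gmulxV.
Qed.
Lemma ginv1 : inv one = one.
Proof. by rewrite -[LHS]gmul1x gmulxV. Qed.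

(* A confluent rewriting system for free groups: two words are equal in every
   group iff this rule brings them to the same normal form. *)
Definition groupE :=
  (gmulA_rev, gmulK, gmulVK, gmulVx, gmulxV, gmul1x, gmulx1, ginvK,
   ginvM, ginv1).

Lemma comm_mull x u y : [(x ** u) ~ y] = inv u ** [x ~ y] ** u ** [u ~ y].
Proof. by rewrite /comm !groupE. Qed.

Lemma comm_mulr x y v : [x ~ (y ** v)] = [x ~ v] ** (inv v ** [x ~ y] ** v).
Proof. by rewrite /comm !groupE. Qed.

Lemma comm3_eq1 x y z :
  comm3 mul inv x y z = one <-> [x ~ y] ** z = z ** [x ~ y].
Proof.
rewrite /comm3; move: [x ~ y] => c; rewrite /comm; split => [cz1|cz].
  apply: (gmulI (inv z)); apply: (gmulI (inv c)).
  by rewrite gmulK gmulVx !gmulA.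
by rewrite gmulA_rev cz !groupE.
Qed.

Definition centralizer (W : set G) : set G :=
  [set c | forall w, W w -> c ** w = w ** c].

Lemma centralizer_subgroup W : is_subgroup mul inv one (centralizer W).
Proof.
split=> [w _|x y cx cy w Ww|x cx w Ww]; first by rewrite !groupE.
  by rewrite gmulA_rev cy // !gmulA cx.
by apply: (gmulI x); rewrite gmulVK gmulA cx // !groupE.
Qed.

Lemma conj_centralizer {W u c} : W u -> centralizer W c -> inv u ** c ** u = c.
Proof. by move=> Wu cW; rewrite gmulA_rev cW // gmulK. Qed.

Lemma comm3_eq1_translates x y z u v w :
  (forall u' v' w', [set one; u] u' -> [set one; v] v' ->
     [set one; u; v; w] w' ->
     comm3 mul inv (x ** u') (y ** v') (z ** w') = one) ->
  comm3 mul inv u v w = one.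
Proof.
move=> H.
pose W := [set one; u; v; w].
have W1 : W one by left; left; left.
have Wu : W u by left; left; right.
have Wv : W v by left; right.
have Ww : W w by right.
have [C1 CM CV] := centralizer_subgroup W.
(* Taking [w' = one] shows that the commutator [c] commutes with [z]; as it also commutes with
   [z ** w'], it commutes with [w']. *)
have Cxy u' v' : [set one; u] u' -> [set one; v] v' ->
    centralizer W [(x ** u') ~ (y ** v')].
  move=> u'P v'P w' Ww'; set c := [_ ~ _].
  have cz : c ** z = z ** c.
    by have := H _ _ _ u'P v'P W1; rewrite !gmulx1 => /comm3_eq1.
  have /comm3_eq1 := H _ _ _ u'P v'P Ww'; rewrite -/c => czw.
  by apply: (gmulI z); rewrite 2!gmulA -cz gmulA_rev czw gmulA_rev.
(* Conjugation by [u] fixes [[x ~ (y ** v')]], so [comm_mull] makes [[u ~ (y ** v')]] a quotient of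
   two elements of the centralizer. *)
have Cu v' : [set one; v] v' -> centralizer W [u ~ (y ** v')].
  move=> v'P; have := Cxy _ _ (or_intror erefl) v'P.
  have := Cxy _ _ (or_introl erefl) v'P; rewrite gmulx1.
  set c := [x ~ _] => Cc; rewrite comm_mull (conj_centralizer Wu Cc) => Ccu.
  by rewrite -(gmulK c [u ~ _]); apply: CM => //; apply: CV.
have Cuv : centralizer W [u ~ v].
  have := Cu _ (or_intror erefl); have := Cu _ (or_introl erefl).
  rewrite gmulx1.
  move=> Cc; rewrite comm_mulr (conj_centralizer Wv Cc) => Cuvc.
  rewrite -[X in centralizer W X]gmulx1 -(gmulxV [u ~ y]) gmulA.
  by apply: CM => //; apply: CV.
exact/comm3_eq1/Cuv.
Qed.

Definition generated (W : set G) : set G :=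
  [set x | forall S, is_subgroup mul inv one S -> W `<=` S -> S x].

Lemma sub_generated W : W `<=` generated W.
Proof. by move=> x Wx S _; apply. Qed.

Lemma generated_subgroup W : is_subgroup mul inv one (generated W).
Proof.
split=> [S [] //|x y Hx Hy S SG WS|x Hx S SG WS].
  by have [_ SM _] := SG; apply: SM; [apply: Hx|apply: Hy].
by have [_ _ SV] := SG; apply: SV; apply: Hx.
Qed.

Lemma generated_sub W S : is_subgroup mul inv one S -> W `<=` S ->
  generated W `<=` S.
Proof. by move=> SG WS x; apply. Qed.

(** The passage from [W] to [H] is made one variable at a time. For fixed [b], [a |-> [a ~ b]] is
    multiplicative where its values commute with all of [H], so such [a] in [H] form a subgroup;
    [[a ~ b] = inv [b ~ a]] exchanges the two variables. *)
Lemma generated_nilpotent_class_le2 W :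
  nilpotent_class_le2 mul inv one W ->
  nilpotent_class_le2 mul inv one (generated W).
Proof.
move=> nilW; set H := generated W.
have [H1 HM HV] := generated_subgroup W.
have [Z1 ZM ZV] := centralizer_subgroup H.
have comm_left b : (forall a, W a -> centralizer H [a ~ b]) -> H b ->
    forall a, H a -> centralizer H [a ~ b].
  move=> Wab Hb.
  suff: H `<=` H `&` [set a | centralizer H [a ~ b]] by move=> HS a /HS[].
  apply: generated_sub; last first.
    by move=> a Wa; split; [exact: sub_generated|exact: Wab].
  split=> [|x y [Hx Zx] [Hy Zy]|x [Hx Zx]]; split=> //.
  - by rewrite /= /comm !groupE.
  - exact: HM.
  - by rewrite /= comm_mull (conj_centralizer Hy Zx); exact: ZM.
  - exact: HV.
  - suff E : [inv x ~ b] = inv [x ~ b] by rewrite /= E; exact: ZV.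
    apply: (gmulI [x ~ b]).
    by rewrite -{1}(conj_centralizer (HV _ Hx) Zx) /comm !groupE.
have WW a b : W a -> W b -> centralizer H [a ~ b].
  (* The elements commuting with [[a ~ b]] form a subgroup, so it is enough that it contains [W]. *)
  move=> Wa Wb; suff: H `<=` centralizer [set [a ~ b]].
    by move=> HC c /HC /(_ _ erefl).
  apply: generated_sub; first exact: centralizer_subgroup.
  by move=> c Wc _ ->; apply/esym/comm3_eq1/nilW.
have comm_inv a b : [a ~ b] = inv [b ~ a] by rewrite /comm !groupE.
have HW b a : W b -> H a -> centralizer H [a ~ b].
  move=> Wb Ha; apply: comm_left => //; last exact: sub_generated.
  by move=> c Wc; apply: WW.
move=> a b c Ha Hb Hc; apply/comm3_eq1.
have: centralizer H [a ~ b]; last exact.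
by apply: comm_left => // d Wd; rewrite comm_inv; apply: ZV; apply: HW.
Qed.

End Group.

Arguments generated {G} mul inv one W.
Arguments generated_subgroup {G} mul inv one W.

(** * Uniform neighbourhoods and finite covers in a compact group *)

Section CompactGroup.
Context {T : ptopologicalType} {mul : T -> T -> T} {inv : T -> T} {one : T}.
Hypothesis HG : group_axioms mul inv one.
Hypothesis mul_cts : continuous (fun p : T * T => mul p.1 p.2).
Hypothesis inv_cts : continuous inv.
Hypothesis cptT : compact [set: T].
Local Notation "x ** y" := (mul x y) (at level 40, left associativity).
Local Notation groupE := (groupE HG).

Lemma mul_cts_comp {U : topologicalType} (f g : U -> T) :
  continuous f -> continuous g -> continuous (fun x => f x ** g x).
Proof.
move=> cf cg x.
have fg : {for x, continuous (fun x => (f x, g x))}.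
  exact: cvg_pair (cf x) (cg x).
exact: (continuous_comp fg (mul_cts (f x, g x))).
Qed.

Lemma mul_cts_l g : continuous (mul g).
Proof.
by apply: (mul_cts_comp (cst g) id) => z; [exact: cvg_cst|exact: cvg_id].
Qed.

Lemma mul_cts_r g : continuous (mul ^~ g).
Proof.
by apply: (mul_cts_comp id (cst g)) => z; [exact: cvg_id|exact: cvg_cst].
Qed.

(** A tube-lemma argument: compactness of [K] makes the neighbourhood of [one] uniform in [k]. *)
Lemma closed_nearl (K U : set T) : closed K -> open U -> K `<=` U ->
  \forall v \near one, forall k, K k -> U (v ** k).
Proof.
move=> clK oU KU.
have /compact_near_coveringP cK := subclosed_compact clK cptT (@subsetT _ K).
apply: (cK _ (nbhs one) (fun v k => U (v ** k))) => k Kk.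
have cts : continuous (fun p : T * T => p.2 ** p.1).
  by apply: mul_cts_comp => p; [exact: cvg_snd|exact: cvg_fst].
apply: (cts (k, one)); apply: open_nbhs_nbhs; split => //=.
by rewrite groupE; exact: KU.
Qed.

Lemma closed_nearr (K U : set T) : closed K -> open U -> K `<=` U ->
  \forall v \near one, forall k, K k -> U (k ** v).
Proof.
move=> clK oU KU.
have /compact_near_coveringP cK := subclosed_compact clK cptT (@subsetT _ K).
apply: (cK _ (nbhs one) (fun v k => U (k ** v))) => k Kk.
apply: (mul_cts (k, one)); apply: open_nbhs_nbhs; split => //=.
by rewrite groupE; exact: KU.
Qed.

Lemma finite_translates_cover (V : set T) : open V -> V one ->
  exists s : seq T, forall x, exists2 y, y \in s & V (inv y ** x).
Proof.
move=> oV V1.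
have := cptT; rewrite compact_cover.
move=> /(_ T setT (fun y => [set x | V (inv y ** x)])) [y _|x _|D _ covD].
- by apply: open_comp => // x _; exact: mul_cts_l.
- by exists x => //=; rewrite groupE.
- by exists (finmap.enum_fset D) => x; have [y yD Vx] := covD x I; exists y.
Qed.

(** * Haar measure: inversion and intersections of translates *)

Section Haar.
Context {R : realType}.
Local Notation borel := (g_sigma_algebraType (@open T)).
Variable mu : {measure set borel -> \bar R}.
Hypothesis mu1 : mu setT = 1%E.
Hypothesis muM : forall g (A : set borel), measurable A ->
  mu (mul g @` A) = mu A.
Hypothesis mu_outer : forall A : set borel, measurable A ->
  mu A = ereal_inf [set mu U | U in
           [set U : set borel | @open T U /\ A `<=` U]].

Lemma open_borel {U : set T} : open U -> measurable (U : set borel).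
Proof. by move=> oU; exact: sub_sigma_algebra. Qed.

Lemma closed_borel {K : set T} : closed K -> measurable (K : set borel).
Proof.
move=> clK; rewrite -(setCK K); apply: measurableC.
by apply: open_borel; exact: closed_openC.
Qed.

Lemma haar_translate g (A : set borel) : measurable A ->
  mu [set x | A (g ** x)] = mu A.
Proof.
move=> mA; rewrite -(muM (inv g) _ mA); congr (mu _).
apply/seteqP; split=> [x Agx|_ [x Ax <-]] /=; last by rewrite groupE.
by exists (g ** x) => //; rewrite groupE.
Qed.

Lemma haar_le1 {A : set borel} : measurable A -> (mu A <= 1)%E.
Proof. by move=> mA; rewrite -mu1; apply: le_measure; rewrite ?inE. Qed.

Lemma haar_fin {A : set borel} : measurable A -> mu A \is a fin_num.
Proof.
by move=> mA; rewrite ge0_fin_numE // (le_lt_trans (haar_le1 mA)) ?ltry.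
Qed.

(* Both sides come from integrating the indicator of [x^-1 y \in K] over
   [(x, y)]; the [y]-variable is discretized so as to need no Fubini theorem,
   which is not available for the Borel sets of a product. *)
Lemma haar_inv_le (K : set T) : closed K -> (mu [set x | K (inv x)] <= mu K)%E.
Proof.
move=> clK; have mK := closed_borel clK.
rewrite (mu_outer _ mK); apply/ereal_infP => _ [U [oU KU] <-].
have [V [oV V1] KVU] : exists2 V : set T, open V /\ V one &
    forall v, V v -> forall k, K k -> U (k ** v).
  have : nbhs one [set v | forall k, K k -> U (k ** v)] by exact: closed_nearr.
  rewrite nbhsE => -[V [oV V1] VU].
  by exists V.
have [s sP] := finite_translates_cover _ oV V1.
pose y i := nth one s i; pose n := size s.
(* The [B i] with [i < n] partition the group into Borel pieces, [B i] lying in [y i ** V]; the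
   second variable is replaced by [y i] on [B i]. *)
pose F i := [set x | V (inv (y i) ** x)]; pose B := seqDU F.
have mB i : measurable (B i : set borel).
  apply: seqDU_measurable => j; apply: open_borel.
  by apply: open_comp => // x _; exact: mul_cts_l.
have mA i : measurable ([set x | K (inv x ** y i)] : set borel).
  apply: closed_borel; apply: preimage_closed => // x _.
  exact: (continuous_comp (inv_cts x) (mul_cts_r (y i) (inv x))).
have B1 : \sum_(i < n) mu (B i) = 1%E.
  rewrite -mu1 -(measure_bigsetU mu) //; last exact: trivIset_seqDU.
  congr (mu _); rewrite -(bigsetU_seqDU F) -bigcup_mkord; apply/seteqP.
  split=> // x _; have [z zs Vz] := sP x.
  by exists (index z s); rewrite /= ?index_mem // /F /= /y nth_index.
pose f i x := (mu (B i) * (\1_[set z | K (inv z ** y i)] x)%:E)%E.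
have m1 i : measurable_fun [set: borel]
    (fun x => (\1_[set z | K (inv z ** y i)] x)%:E : \bar R).
  apply/measurable_EFinP.
  exact: measurable_indic.
have mf i : measurable_fun [set: borel] (f i) by exact: measurable_funeM.
have f0 i x : (0 <= f i x)%E by rewrite mule_ge0 // lee_fin.
(* The pieces with [inv x ** y i] in [K] are disjoint and lie in [x ** U], since multiplying [K] by
   [V] on the right stays in [U]. *)
have le_muU x : (\sum_(i < n) f i x <= mu U)%E.
  have mxU : measurable ([set z | U (inv x ** z)] : set borel).
    by apply: open_borel; apply: open_comp => // z _; exact: mul_cts_l.
  rewrite -(haar_translate (inv x) U); last exact: open_borel.
  pose C i := B i `&` [set _ | K (inv x ** y i)].
  have mC i : measurable (C i : set borel).
    rewrite /C; have [Ki|nKi] := pselect (K (inv x ** y i)).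
      by rewrite (_ : [set _ | _] = setT) ?setIT //; apply/seteqP; split.
    by rewrite (_ : [set _ | _] = set0) ?setI0 //; apply/seteqP; split.
  rewrite (eq_bigr (fun i : 'I_n => mu (C i))); last first.
    move=> i _; rewrite /f indicE /C.
    have [Ki|nKi] := pselect (K (inv x ** y i)).
      rewrite mem_set // mule1 (_ : [set _ | _] = setT) ?setIT //.
      by apply/seteqP; split.
    rewrite memNset // mule0 (_ : [set _ | _] = set0) ?setI0 ?measure0 //.
    by apply/seteqP; split.
  rewrite -(measure_bigsetU mu) //; last first.
    by apply: trivIset_setIr; exact: trivIset_seqDU.
  apply: le_measure; rewrite ?inE //; first exact: bigsetU_measurable.
  rewrite -bigcup_mkord => z [i _ [Bz Kx]].
  have Vz : V (inv (y i) ** z) := subset_seqDU Bz.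
  by have := KVU _ Vz _ Kx; rewrite !groupE.
have : (\int[mu]_x (\sum_(i < n) f i x) <= \int[mu]_x (mu U))%E.
  apply: ge0_le_integral => //; last exact: emeasurable_sum.
  by move=> x _; exact: sume_ge0.
rewrite integral_cst // mu1 mule1 ge0_integral_sum //.
(* Translating [x] by [y i] makes the integral of the indicator independent of [i]; the weights
   [mu (B i)] sum to 1. *)
apply: le_trans; rewrite (eq_bigr (fun i : 'I_n =>
    mu (B i) * mu [set x | K (inv x)]))%E; last first.
  move=> i _; rewrite /f ge0_integralZl //.
  rewrite integral_indic // setIT; congr (_ * _)%E.
  rewrite -(haar_translate (inv (y i)) [set x | K (inv x)]); last first.
    by apply: closed_borel; exact: preimage_closed.
  by congr (mu _); apply/seteqP; split=> x /=; rewrite !groupE.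
by rewrite -ge0_sume_distrl // B1 mul1e.
Qed.

(** An open [U] containing [M] with [mu U < mu M + e] contains the sets [inv v ** M] for [v] near
    [one], and each misses at most [e] of its measure. As [e] is [mu M] divided by [n.+1], at most
    [n] such losses total less than [mu M], so they cannot cover [U]. *)
Lemma near_translates_meet (M : set T) (n : nat) : closed M -> (0 < mu M)%E ->
  exists2 V : set T, nbhs one V &
    forall s : seq T, (size s <= n)%N -> {in s, forall v, V v} ->
      exists x, {in s, forall v, M (v ** x)}.
Proof.
move=> clM muM0; have mM := closed_borel clM.
have fM := haar_fin mM.
pose e := fine (mu M) / n.+1%:R.
have fM0 : 0 < fine (mu M).
  by rewrite fine_gt0 // muM0 (le_lt_trans (haar_le1 mM)) ?ltry.
have e0 : 0 < e by rewrite divr_gt0.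
have [] := lb_ereal_inf_adherent (S := [set mu U | U in
    [set U : set borel | @open T U /\ M `<=` U]]) e0.
  by rewrite -mu_outer.
move=> _ [U [oU MU] <-]; rewrite -mu_outer // => muU.
have mU := open_borel oU.
have nearV : \forall v \near one, forall k, M k -> U (inv v ** k).
  have cinv : inv @ one --> one by rewrite -{2}(ginv1 HG); exact: inv_cts.
  exact: cinv (closed_nearl _ _ clM oU MU).
exists [set v | forall k, M k -> U (inv v ** k)] => // s sn sV.
apply: contrapT => noX.
pose A i := [set x | M (nth one s i ** x)].
have mA i : measurable (A i : set borel).
  by apply: closed_borel; apply: preimage_closed => // x _; exact: mul_cts_l.
have muA i : mu (A i) = mu M by exact: haar_translate.
have AU i : (i < size s)%N -> A i `<=` U.
  by move=> si x Ax; have := sV _ (mem_nth one si) _ Ax; rewrite groupE.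
have : (mu U <= \sum_(i < size s) mu (U `\` A i))%E.
  have mUA i : measurable (U `\` A i : set borel) by exact: measurableD.
  apply: le_trans (Boole_inequality mu (n := size s) (fun i _ => mUA i)).
  apply: le_measure; rewrite ?inE //; first exact: bigsetU_measurable.
  rewrite -(bigcup_mkord _ (fun i => U `\` A i)) => x Ux.
  apply: contrapT => nx; apply: noX.
  exists x => v vs; apply: contrapT => nMv; apply: nx.
  exists (index v s); rewrite /= ?index_mem //.
  by split; rewrite // /A /= nth_index.
apply/negP; rewrite -ltNge.
apply: (@le_lt_trans _ _ (\sum_(i < size s) e%:E)%E).
  apply: lee_sum => i _.
  have -> : mu (U `\` A i) = (mu U - mu (A i))%E.
    by rewrite measureD ?ltey_eq ?haar_fin // (setIidr (AU i _)).
  by rewrite muA leeBlDl //; exact: ltW.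
rewrite sumEFin big_const_ord iter_addr_0.
apply: lt_le_trans (_ : mu M <= mu U)%E; last first.
  by apply: le_measure; rewrite ?inE.
rewrite -[X in (_ < X)%E]fineK // lte_fin.
apply: (@le_lt_trans _ _ (e *+ n)).
  by apply: ler_wpMn2l => //; exact: ltW.
rewrite -[X in _ < X](divfK (_ : n.+1%:R != 0)) // -/e mulr_natr mulrS.
by rewrite ltrDr.
Qed.

End Haar.
End CompactGroup.

Definition inv3 {G : Type} (inv : G -> G) (p : G * G * G) : G * G * G :=
  (inv p.1.1, inv p.1.2, inv p.2).

(** * The cube of [G] as a compact group, and closedness of [N2] *)

Section Cube.
Context {G : ptopologicalType} {mul : G -> G -> G} {inv : G -> G} {one : G}.
Hypothesis HG : compact_hausdorff_group mul inv one.

Lemma cube_group_axioms : group_axioms (mul3 mul) (inv3 inv) (one, one, one).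
Proof.
have [HA _ _ _ _] := HG.
by split=> [[[a b] c] [[x y] z] [[u v] w]|[[x y] z]|[[x y] z]|[[x y] z]
  |[[x y] z]]; rewrite /mul3 /inv3 /= ?(gmulA HA) // !(groupE HA).
Qed.

Lemma continuous_triple (U : topologicalType) (f : U -> G * G * G) :
  continuous (fun x => (f x).1.1) -> continuous (fun x => (f x).1.2) ->
  continuous (fun x => (f x).2) -> continuous f.
Proof.
move=> f1 f2 f3 x.
have -> : f = (fun x => ((f x).1.1, (f x).1.2, (f x).2)).
  by apply/funext => y; case: (f y) => [[]].
exact: cvg_pair (cvg_pair (f1 x) (f2 x)) (f3 x).
Qed.

Lemma fst_cts {U V : topologicalType} : continuous (@fst U V).
Proof. by move=> x; exact: cvg_fst. Qed.

Lemma snd_cts {U V : topologicalType} : continuous (@snd U V).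
Proof. by move=> x; exact: cvg_snd. Qed.

Lemma cts_comp {U V W : topologicalType} (f : U -> V) (g : V -> W) :
  continuous f -> continuous g -> continuous (fun x => g (f x)).
Proof. by move=> cf cg x; exact: (continuous_comp (cf x) (cg (f x))). Qed.

Lemma cube_mul_cts :
  continuous (fun p : (G * G * G) * (G * G * G) => mul3 mul p.1 p.2).
Proof.
have [_ cm _ _ _] := HG.
apply: continuous_triple => /=; apply: (mul_cts_comp cm);
  repeat (exact: fst_cts || exact: snd_cts ||
    apply: (cts_comp _ fst) || apply: (cts_comp _ snd)).
Qed.

Lemma cube_inv_cts : continuous (inv3 inv).
Proof.
have [_ _ ci _ _] := HG.
apply: continuous_triple => /=; apply: (cts_comp _ inv ) => //;
  repeat (exact: fst_cts || exact: snd_cts ||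
    apply: (cts_comp _ fst) || apply: (cts_comp _ snd)).
Qed.

Lemma cube_compact : compact [set: G * G * G].
Proof.
have [_ _ _ _ cG] := HG.
by rewrite -!setXTT; apply: compact_setX => //; exact: compact_setX.
Qed.

Lemma N2_closed : closed (N2 mul inv one).
Proof.
have [HA cm ci hG _] := HG.
have cc (f g : G * G * G -> G) : continuous f -> continuous g ->
    continuous (fun p => comm mul inv (f p) (g p)).
  move=> cf cg; rewrite /comm.
  have civ (h : G * G * G -> G) :
      continuous h -> continuous (fun p => inv (h p)).
    by move=> ch; exact: (cts_comp h inv ch ci).
  by do !apply: (mul_cts_comp cm) => //; apply: civ.
have /preimage_closed : {in ~` (fun p : G * G * G =>
    comm3 mul inv p.1.1 p.1.2 p.2) @^-1` [set one],
    continuous (fun p : G * G * G => comm3 mul inv p.1.1 p.1.2 p.2)}.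
  have f12 : continuous (fun p : G * G * G => comm mul inv p.1.1 p.1.2).
    by apply: (cc); apply: (cts_comp fst);
      by [exact: fst_cts|exact: snd_cts].
  by move=> p _; apply: (cc _ snd f12) => q; exact: cvg_snd.
by apply; apply: accessible_closed_set1; exact: hausdorff_accessible.
Qed.

End Cube.

(** * From positive measure to an open subgroup *)

Theorem theorem3p2 (R : realType) (G : ptopologicalType)
  (mul : G -> G -> G) (inv : G -> G) (one : G)
  (HG : compact_hausdorff_group mul inv one)
  (mu : {measure set (borel3 G) -> \bar R})
  (Hmu : haar_prob mul mu) :
  (0 < mu (N2 mul inv one))%E ->
  exists H : set G, [/\ open H, is_subgroup mul inv one H
                      & nilpotent_class_le2 mul inv one H].
Proof.
move=> N2_gt0; have [HA cm _ _ _] := HG; have HA3 := cube_group_axioms HG.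
have cm3 := cube_mul_cts HG; have ci3 := cube_inv_cts HG.
have cpt := cube_compact HG; have [mu1 muM mu_outer] := Hmu.
pose M := inv3 inv @^-1` N2 mul inv one.
have clM : closed M.
  by apply: preimage_closed => [p _|]; [exact: ci3|exact: N2_closed].
have M_gt0 : (0 < mu M)%E.
  have := haar_inv_le HA3 cm3 ci3 cpt mu mu1 muM mu_outer _ clM.
  apply: lt_le_trans; rewrite (_ : [set x | _] = N2 mul inv one) //.
  by rewrite /M; apply/seteqP; split=> x /=; rewrite (ginvK HA3).
have [V V1 VM] := near_translates_meet HA3 cm3 ci3 cpt mu mu1 muM mu_outer
  _ 16 clM M_gt0.
have [W W1 WN] : exists2 W : set G, nbhs one W &
    nilpotent_class_le2 mul inv one W.
  have V1' : nbhs (inv3 inv (one, one, one)) V.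
    by rewrite /inv3 /= (ginv1 HA).
  (* The preimage of [V] under inversion contains a box; intersecting its sides lets any of [one],
     [a], [b], [c] serve in any coordinate. *)
  have [[P P3] /= [[[P1 P2] /= [P1n P2n] P12] P3n] PV] :=
    ci3 (one, one, one) _ V1'.
  exists (P1 `&` P2 `&` P3); first by do !apply: filterI.
  move=> a b c Wa Wb Wc.
  have Pabc z : z \in [:: one; a; b; c] -> [/\ P1 z, P2 z & P3 z].
    have [[? ?] ?] := Wa; have [[? ?] ?] := Wb; have [[? ?] ?] := Wc.
    by rewrite !inE => /or4P[] /eqP->; split=> //; exact: nbhs_singleton.
  (* These are 2 * 2 * 4 = 16 triples. They are inverted because, for [q = (u, v, w)], having
     [q^-1 p] in [M] means that [p^-1 q] is in [N2]; hence the base point [(inv x, inv y, inv z)]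
     below. *)
  pose s := [seq inv3 inv (p.1, p.2, w) |
    p <- [seq (u, v) | u <- [:: one; a], v <- [:: one; b]],
    w <- [:: one; a; b; c]].
  have sV : {in s, forall v, V v}.
    move=> _ /allpairsP[[p w] [/allpairsP[[u v] [us vs ->]] ws ->]].
    apply: (PV (u, v, w)); split; [apply: P12; split|].
    - have [] // := Pabc u.
      by move: us; rewrite !inE => /orP[] ->; rewrite ?orbT.
    - have [] // := Pabc v.
      by move: vs; rewrite !inE => /orP[] ->; rewrite ?orbT.
    - by have [] := Pabc w.
  have [//|[[x y] z] xP] := VM s _ sV.
  apply: (comm3_eq1_translates HA (inv x) (inv y) (inv z)) => u v w uP vP wP.
  suff /xP : inv3 inv (u, v, w) \in s.
    by rewrite /M /N2 /= !(ginvM HA) !(ginvK HA).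
  apply/allpairsP; exists ((u, v), w); split=> //.
    apply/allpairsP; exists (u, v); split=> //=; rewrite !inE.
      by case: uP => ->; rewrite eqxx ?orbT.
    by case: vP => ->; rewrite eqxx ?orbT.
  by rewrite !inE; case: wP => [[[]|]|] ->; rewrite eqxx ?orbT.
exists (generated mul inv one W); split.
(* The translate of [W] by [x] is a neighbourhood of [x] inside the subgroup. *)
- rewrite openE => x Hx; rewrite /interior.
  have : nbhs x [set y | W (mul (inv x) y)].
    by apply: (mul_cts_l cm (inv x) x); rewrite (gmulVx HA).
  apply: filterS => y Wy; rewrite -(gmulVK HA x y).
  have [_ HM _] := generated_subgroup mul inv one W.
  by apply: HM => //; exact: sub_generated.
- exact: generated_subgroup.
- exact: generated_nilpotent_class_le2.
Qed.
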